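(* Let $m,n$ be positive integers and let $f:\mathbb{Z}_{\geq 0}\to\mathbb{Z}_{\geq 0}$ be an increasing function. For an increasing function $h:\mathbb{Z}_{\geq 0}\to\mathbb{Z}_{\geq 0}$ let $\bar\mu(h)$ be the greedy antichain sequence of $\mathbb{Z}_{\geq 0}^m$ associated with $h$ (defined in the context). Define recursively, for $j=1,\dots,n$, $$f_{j-1}(x)=f(x+L_1+\cdots+L_{j-1}),\qquad \bar\mu(f_{j-1})=(\mu^{(j)}_1,\dots,\mu^{(j)}_{L_j}),\qquad \bar\mu^{(j)}=\big((\mu^{(j)}_1,j-1),\dots,(\mu^{(j)}_{L_j},j-1)\big),$$ where $L_j$ is the length of $\bar\mu(f_{j-1})$ (and $f_0=f$). Let $\bar\mu$ be the concatenation of $\bar\mu^{(1)},\dots,\bar\mu^{(n)}$, which is an antichain sequence of $\mathbb{Z}_{\geq 0}^m\times n$ with degree growth bounded by $f$. Then $\bar\mu$ has the maximal length among the antichain sequences of $\mathbb{Z}_{\geq 0}^m\times n$ with degree growth bounded by $f$. In particular, $\mathfrak{L}_{f,m}^n=L_1+\cdots+L_n$.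
   Context: ''Increasing'' means $f(i)\leq f(j)$ whenever $i\leq j$. Write $n=\{0,1,\dots,n-1\}$ and order $\mathbb{Z}_{\geq 0}^m\times n$ by: $(\tau,i)\leq(\eta,j)$ iff $i=j$ and $\tau\leq\eta$ in the product (coordinatewise) order of $\mathbb{Z}_{\geq 0}^m$. The degree of $\tau=(\tau_1,\dots,\tau_m)$, and of $(\tau,i)$, is $\tau_1+\cdots+\tau_m$. An antichain sequence of $\mathbb{Z}_{\geq 0}^m\times n$ (or of $\mathbb{Z}_{\geq 0}^m$) is a finite sequence $a_1,\dots,a_k$ with $a_i\nleq a_j$ for all $i\neq j$; its degree growth is bounded by $f$ if $\deg a_i\leq f(i)$ for all $1\leq i\leq k$. $\mathfrak{L}_{f,m}^n$ is the maximal length of an antichain sequence of $\mathbb{Z}_{\geq 0}^m\times n$ with degree growth bounded by $f$. The degree-lexicographic order $\prec$ on $\mathbb{Z}_{\geq 0}^m$: $\tau\prec\eta$ iff $\deg\tau<\deg\eta$, or $\deg\tau=\deg\eta$ and $\tau$ is less than $\eta$ lexicographically (comparison at the first coordinate where they differ). Greedy antichain sequence: for an increasing $h:\mathbb{Z}_{\geq 0}\to\mathbb{Z}_{\geq 0}$, $\bar\mu(h)=(\mu_1,\mu_2,\dots)$ is defined by $\mu_1=\max_{\prec}\{\xi\in\mathbb{Z}_{\geq 0}^m:\deg\xi=h(1)\}$ and, as long as the set is nonempty, $\mu_i=\max_{\prec}\{\xi\in\mathbb{Z}_{\geq 0}^m:\deg\xi=h(i)\text{ and }\xi\ngeq\mu_j\text{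 for all }1\le j\leq i-1\}$; it stops at the first index where the set is empty, and is a finite antichain sequence with degree growth bounded by $h$. *)

(* Defs.v *)
From HB Require Import structures.
From Stdlib Require Import Classical ClassicalEpsilon.
From mathcomp Require Import all_boot all_order.
From mathcomp Require Import mpoly.

Set Implicit Arguments.
Unset Strict Implicit.
Unset Printing Implicit Defensive.

Import Order.TTheory.

(* Z_{>=0}^m is the type of exponent vectors 'X_{1..m}, with two orders:
   (x <= y)%MM is the product order and (x <= y)%O the degree-lexicographic
   order.  The header of mpoly calls the latter degrevlex, but ties in degree
   are broken at the first differing coordinate, the larger entry being the
   larger vector: see ltmcP. *)

Section Antichains.
Variables m n : nat.

Definition pt_le (a b : 'X_{1..m} * 'I_n) : bool :=
  (a.2 == b.2) && (a.1 <= b.1)%MM.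

Definition pt_deg (a : 'X_{1..m} * 'I_n) : nat := mdeg a.1.

Definition antichain_seq (s : seq ('X_{1..m} * 'I_n)) : Prop :=
  forall i j : 'I_(size s), i != j ->
    ~~ pt_le (tnth (in_tuple s) i) (tnth (in_tuple s) j).

(* Sequences are numbered from 1 in the bound deg a_i <= f i, hence i.+1. *)
Definition degree_growth_le (f : nat -> nat)
    (s : seq ('X_{1..m} * 'I_n)) : Prop :=
  forall i : 'I_(size s), pt_deg (tnth (in_tuple s) i) <= f i.+1.

Definition is_max_antichain_length (f : nat -> nat) (N : nat) : Prop :=
  (exists s : seq ('X_{1..m} * 'I_n),
     [/\ antichain_seq s, degree_growth_le f s & size s = N]) /\
  (forall s : seq ('X_{1..m} * 'I_n),
     antichain_seq s -> degree_growth_le f s -> size s <= N).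

End Antichains.

Section Greedy.
Variable m : nat.

Definition candidate (d : nat) (s : seq 'X_{1..m}) (x : 'X_{1..m}) : bool :=
  (mdeg x == d) && all (fun y => ~~ (y <= x)%MM) s.

Definition is_deglex_max (P : pred 'X_{1..m}) (x : 'X_{1..m}) : Prop :=
  P x /\ forall y, P y -> (y <= x)%O.

(* The vectors of degree d all lie in the finite type 'X_{1..m < d.+1}, over
   which the maximum is searched. *)
Definition greedy_next (d : nat) (s : seq 'X_{1..m}) : option 'X_{1..m} :=
  omap (@bmnm m d.+1)
    [pick x : 'X_{1..m < d.+1} | candidate d s x &&
      [forall y : 'X_{1..m < d.+1}, candidate d s y ==> (bmnm y <= bmnm x)%O]].

Lemma greedy_nextP d s :
  match greedy_next d s with
  | Some x => is_deglex_max (candidate d s) x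
  | None => forall x, ~~ candidate d s x
  end.
Proof.
rewrite /greedy_next; case: pickP => [x /andP[cx /forallP mx] | no] /=.
  split=> // y cy.
  have dy : mdeg y < d.+1 by case/andP: cy => /eqP ->.
  by have /implyP := mx (BMultinom dy); apply.
move=> x; apply/negP => cx.
have dx : mdeg x < d.+1 by case/andP: cx => /eqP ->.
pose P (z : 'X_{1..m < d.+1}) := candidate d s z.
have Px : P (BMultinom dx) by [].
case: (Order.TotalTheory.arg_maxP (@bmnm m d.+1) Px) => z cz mz.
have /negP[] := negbT (no z); apply/andP; split=> //.
by apply/forallP => y; apply/implyP => cy; apply: mz.
Qed.

Fixpoint greedy_prefix (h : nat -> nat) (k : nat) : seq 'X_{1..m} :=
  if k is k'.+1 then
    let s := greedy_prefix h k' in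
    if greedy_next (h k) s is Some x then rcons s x else s
  else [::].

End Greedy.

Section Dickson.

Lemma ex_tail_min (u : nat -> nat) N :
  exists n, N <= n /\ forall p, N <= p -> u n <= u p.
Proof.
have [k] : exists k, exists2 n, N <= n & u n <= k by exists (u N), N.
elim: k => [|k IH] [n Nn un].
  by exists n; split=> // p _; rewrite (leq_trans un).
have [[p Np up] | no] := classic (exists2 p, N <= p & u p <= k).
  by apply: IH; exists p.
exists n; split=> // p Np; apply: (leq_trans un); rewrite ltnNge.
by apply/negP => up; apply: no; exists p.
Qed.

Lemma monotone_subseq (u : nat -> nat) :
  exists g : nat -> nat, {homo g : i j / i < j} /\
    {homo (u \o g) : i j / i <= j}.
Proof.
pose t N := proj1_sig (constructive_indefinite_description _ (ex_tail_min u N)).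
have tP N : N <= t N /\ forall p, N <= p -> u (t N) <= u p.
  by rewrite /t; case: (constructive_indefinite_description _ _).
pose g := fix g k := if k is k'.+1 then t (g k').+1 else t 0.
have gS k : g k < g k.+1 by rewrite /=; case: (tP (g k).+1).
exists g; split; first exact: (homo_ltn ltn_trans).
apply: (homo_leq leqnn leq_trans) => k /=.
have [_ +] := tP (g k).+1.
have [Ng _] := tP (g k).+1; move=> _.
case: k Ng => [|k] Ng.
  by case: (tP 0) => _; apply.
case: (tP (g k).+1) => le1; apply; apply: leq_trans Ng.
by apply: leq_trans (leqnSn _); exact: le1.
Qed.

Lemma dickson m (a : nat -> 'X_{1..m}) :
  exists i j, i < j /\ (a i <= a j)%MM.
Proof.
have [g [gmono gP]] : exists g : nat -> nat, {homo g : i j / i < j} /\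
    forall c : 'I_m, c < m -> {homo (fun k => a (g k) c) : i j / i <= j}.
  have: forall k, exists g : nat -> nat, {homo g : i j / i < j} /\
    forall c : 'I_m, c < k -> {homo (fun k => a (g k) c) : i j / i <= j}.
    elim=> [|k [g [gm gP]]]; first by exists id; split.
    have [km | mk] := ltnP k m; last first.
      by exists g; split=> // c _; apply: gP; apply: leq_trans mk.
    have [g' [gm' gP']] := monotone_subseq (fun i => a (g i) (Ordinal km)).
    exists (g \o g'); split=> [i j ij | c]; first exact/gm/gm'.
    rewrite ltnS leq_eqVlt => /orP[/eqP ck | ck] i j ij /=.
      have -> : c = Ordinal km by apply: val_inj.
      exact: gP'.
    apply: (gP _ ck); move: ij; rewrite leq_eqVlt => /orP[/eqP -> // | ij].
    exact/ltnW/gm'.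
  by apply.
exists (g 0), (g 1); split; first exact: gmono.
by apply/mnm_lepP => c; apply: (gP c (ltn_ord c)).
Qed.

End Dickson.

Section GreedySequence.
Variable m : nat.

Lemma greedy_stops (h : nat -> nat) :
  exists k, greedy_next (h k.+1) (greedy_prefix m h k) == None.
Proof.
apply: NNPP => no.
pose a k := odflt 0%MM (greedy_next (h k.+1) (greedy_prefix m h k)).
have aP k : greedy_next (h k.+1) (greedy_prefix m h k) = Some (a k).
  rewrite /a; case E: greedy_next => [x //|]; case: no; exists k.
  by rewrite E.
have pS k : greedy_prefix m h k.+1 = rcons (greedy_prefix m h k) (a k).
  by rewrite /= aP.
have mem i j : i < j -> a i \in greedy_prefix m h j.
  elim: j => // j IH; rewrite ltnS leq_eqVlt pS mem_rcons inE.
  by case/orP=> [/eqP -> | /IH ->]; rewrite ?eqxx ?orbT.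
have [i [j [ij le]]] := dickson a.
have := greedy_nextP (h j.+1) (greedy_prefix m h j); rewrite aP.
by case=> /andP[_ /allP /(_ _ (mem _ _ ij))]; rewrite le.
Qed.

Definition greedy (h : nat -> nat) : seq 'X_{1..m} :=
  greedy_prefix m h (ex_minn (greedy_stops h)).

Lemma greedyP (h : nat -> nat) :
  (forall i, i < size (greedy h) ->
     is_deglex_max (candidate (h i.+1) (take i (greedy h)))
       (nth 0%MM (greedy h) i)) /\
  (forall x, ~~ candidate (h (size (greedy h)).+1) (greedy h) x).
Proof.
rewrite /greedy; case: ex_minnP => k /eqP stop kmin.
pose s := greedy_prefix m h.
have sP i : i < k -> exists2 x, s i.+1 = rcons (s i) x &
    is_deglex_max (candidate (h i.+1) (s i)) x.
  move=> ik; have := greedy_nextP (h i.+1) (s i); rewrite /s /=.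
  case E: greedy_next => [x|]; first by exists x.
  by move: ik; rewrite ltnNge kmin // E.
have ss i : i <= k -> size (s i) = i.
  elim: i => // i IH ik; have [x -> _] := sP i ik.
  by rewrite size_rcons IH // ltnW.
have tk i : i <= k -> take i (s k) = s i.
  move=> ik; rewrite -(subnKC ik); have: i + (k - i) <= k by rewrite subnKC.
  elim: (k - i) => [|j IH] le.
    by rewrite addn0 -[X in take X _](ss i ik) take_size.
  move: le; rewrite addnS => le; have [x -> _] := sP _ le.
  have le' := ltnW le.
  by rewrite -cats1 takel_cat ?IH // ss // leq_addr.
rewrite (ss k) //; split=> [i ik|x].
  rewrite tk; last exact: ltnW.
  have [x sx] := sP i ik.
  rewrite -(nth_take 0%MM (ltnSn i)) tk // sx nth_rcons ss ?ltnn ?eqxx //.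
  exact: ltnW.
have := greedy_nextP (h k.+1) (s k).
by rewrite /s stop.
Qed.

End GreedySequence.

Section Concatenation.
Variables (m n : nat) (f : nat -> nat).

(* block_start j is L_1 + ... + L_j: see block_startE.  Blocks are numbered
   from 0, so that block_fun j is f_j and block_length j is L_{j+1}. *)
Fixpoint block_start (j : nat) : nat :=
  if j is j'.+1
  then block_start j' + size (greedy m (fun x => f (x + block_start j')))
  else 0.

Definition block_fun (j : nat) : nat -> nat := fun x => f (x + block_start j).

Definition block_length (j : nat) : nat := size (greedy m (block_fun j)).

Lemma block_startE j : block_start j = \sum_(i < j) block_length i.
Proof. by elim: j => [|j IH]; rewrite ?big_ord0 // big_ord_recr /= -IH. Qed.

Definition greedy_block (j : 'I_n) : seq ('X_{1..m} * 'I_n) :=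
  [seq (x, j) | x <- greedy m (block_fun j)].

Definition greedy_concat : seq ('X_{1..m} * 'I_n) :=
  flatten [seq greedy_block j | j <- enum 'I_n].

End Concatenation.

(* Main.v *)
Require Import Defs.
From Stdlib Require Import Classical.
From mathcomp Require Import all_boot all_order.
From mathcomp Require Import finmap zify.
From mathcomp Require Import mpoly.

Set Implicit Arguments.
Unset Strict Implicit.
Unset Printing Implicit Defensive.

Import Order.TTheory.
Local Open Scope fset_scope.
Local Open Scope nat_scope.

(** Call layer of degree [d] the set of the points of degree [d] of the [n] copies
    of the set of exponent vectors, and shadow of a subset [A] of a layer the set
    of the points of the next layer that lie above a point of [A].  Order each
    layer by putting the copies one after the other and, within a copy, the
    lexicographically large vectors first.  Everything rests on an extension of
    Macaulay's theorem to several copies, [macaulay]: among the subsets of a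
    layer with a given number of points, the initial segments of this order have
    the smallest shadows.

    Let [t] be the greedy concatenation, [N] its length, and suppose that [s] is a
    longer antichain sequence with degree growth bounded by [f].  For each degree
    [d], let [ideal s d] be the set of the points of degree [d] above an element
    of [s], and [low_count d s] the number of elements of [s] of degree at most
    [d]; likewise for [t].  The [i]-th element of [t] has degree exactly [f i], so
    that [low_count d t <= low_count d s].  By the choice of maximal vectors,
    [ideal t d] is an initial segment ([divided_before], [initial_ideal]).  From
    one degree to the next an ideal is replaced by its shadow together with the
    new elements of the sequence, and for an antichain these are outside the
    shadow.  Macaulay's theorem, with the remark that a larger initial segment
    has a strictly larger shadow, therefore shows that [ideal s d] has at least
    [low_count d s - low_count d t] points more than [ideal t d] ([ideal_excess]).
    In degree [f N.+1] the greedy construction has exhausted every copy and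
    [ideal t d] is the whole layer, whereas [s] has more than [N] elements of at
    most this degree: its ideal would be larger than the layer.

    Macaulay's theorem itself is proved by induction on the number of variables
    allowed to occur.  Compressing a set along the lines in which the last
    variable is traded for another one does not enlarge its shadow, and leads to
    a set stable under replacing the last variable by an earlier one
    ([stabilise]).  For such a set the shadow is governed by the slice of the
    points in which the last variable does not occur, and the slices are chained
    by taking shadows with one variable less, where the induction hypothesis
    applies. *)

(** * Cardinals of finite sets *)

Section FiniteSets.
Variable K : choiceType.
Implicit Types A B : {fset K}.

Lemma leq_card_fibers (g : K -> nat) A B :
  (forall k, #|` [fset x in A | g x == k]| <= #|` [fset x in B | g x == k]|) ->
  #|` A| <= #|` B|.
Proof.
move=> fib.
pose low (C : {fset K}) N := [fset x in C | g x < N].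
have lowS C N : #|` low C N.+1| = #|` low C N| + #|` [fset x in C | g x == N]|.
  have -> : low C N.+1 = low C N `|` [fset x in C | g x == N].
    apply/fsetP => x; rewrite !inE /=; case: (x \in C) => //=.
    by rewrite ltnS leq_eqVlt orbC.
  rewrite -cardfsUI [X in _ = _ + X](_ : _ = 0) ?addn0 //; apply/eqP.
  rewrite cardfs_eq0; apply/eqP/fsetP => x; rewrite !inE /=.
  by apply/negP => /andP[/andP[_ lt]] /andP[_ /eqP eq]; rewrite eq ltnn in lt.
have lowAB N : #|` low A N| <= #|` low B N|.
  elim: N => [|N IH]; last by rewrite !lowS leq_add.
  by rewrite [low A 0](_ : _ = fset0) ?cardfs0 //; apply/fsetP=> x; rewrite !inE ltn0 andbF.
pose N := (\sum_(x <- A) g x).+1.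
have lowA : low A N = A.
  apply/fsetP => x; rewrite !inE /=; case: (boolP (x \in A)) => //= xA.
  by rewrite ltnS (big_fsetD1 x) //= leq_addr.
rewrite -[A in #|` A|]lowA; apply: leq_trans (lowAB N) _.
by apply: fsubset_leq_card; apply/fsubsetP => x; rewrite !inE => /andP[].
Qed.

Lemma leq_card_inj (T : choiceType) (h : K -> T) A (B : {fset T}) :
  {in A &, injective h} -> {in A, forall x, h x \in B} -> #|` A| <= #|` B|.
Proof.
move=> hinj hB; rewrite -[#|` A|](card_in_imfset imfset_key hinj).
by apply: fsubset_leq_card; apply/fsubsetP => _ /imfsetP[x xA ->]; apply: hB.
Qed.

Lemma ltn_card_witness A B x :
  A `<=` B -> x \in B -> x \notin A -> #|` A| < #|` B|.
Proof.
move=> sAB xB xA; have := fsubset_leq_card sAB; rewrite leq_eqVlt => /orP[|//].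
move=> /eqP cAB; move: xA; rewrite (_ : A = B) ?xB //.
by apply/eqP; rewrite eqEfcard sAB cAB leqnn.
Qed.

Lemma fset_least (e : rel K) A x0 : total e -> transitive e -> x0 \in A ->
  exists2 x, x \in A & forall y, y \in A -> e x y.
Proof.
move=> etot etr x0A; have := sort_sorted etot (enum_fset A).
have memE : sort e (enum_fset A) =i A by move=> y; rewrite mem_sort.
case: (sort e (enum_fset A)) memE => [|x t] memE.
  by move=> _; move: x0A; rewrite -memE.
rewrite /= path_sortedE // => /andP[/allP xt _].
exists x; first by rewrite -memE inE eqxx.
move=> y; rewrite -memE inE => /predU1P[->|/xt //].
by have := etot x x; rewrite orbb.
Qed.

End FiniteSets.

(** * Lexicographic comparison of exponent vectors *)

Section Vectors.
Variable m : nat.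
Implicit Types u w x y z : 'X_{1..m}.

Lemma mdeg_eq_le x y : (forall j, x j <= y j) -> mdeg x = mdeg y -> x = y.
Proof.
move=> le; rewrite !mdegE => eqs; apply/mnmP => j; apply/eqP.
rewrite eqn_leq le /= leqNgt; apply/negP => lt.
suff: \sum_(i < m) x i < \sum_(i < m) y i by rewrite eqs ltnn.
rewrite (bigD1 j) //= [X in _ < X](bigD1 j) //=.
by rewrite -addSn leq_add //; apply: leq_sum => i _.
Qed.

Lemma ltmc_diff x y : mdeg x = mdeg y -> (x < y)%O ->
  exists p : 'I_m, (forall q : 'I_m, q < p -> x q = y q) /\ x p < y p.
Proof. by move=> d /(ltmcP d)[p]; exists p. Qed.

Lemma mdeg_pos x : 0 < mdeg x -> exists i, 0 < x i.
Proof.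
rewrite mdegE lt0n sum_nat_eq0 negb_forall => /existsP[i] /=.
by rewrite -lt0n; exists i.
Qed.

Lemma last_nonzero x : 0 < mdeg x ->
  exists2 i : 'I_m, 0 < x i & forall j : 'I_m, i < j -> x j = 0.
Proof.
case/mdeg_pos=> i0 i0P.
case: (@arg_maxnP _ i0 (fun i => 0 < x i) (fun i : 'I_m => nat_of_ord i) i0P) => i iP imax.
exists i => // j ij; apply/eqP; rewrite -leqn0 leqNgt; apply/negP => /imax /=; lia.
Qed.

(** [z] is [u] with one unit moved from the last variable [i] occurring before
    [v] to [v] itself.  A loss against [w] would require [u] to exceed [w] first
    at [i], and by one only; beyond [i], [z] vanishes before [v] and does not
    exceed [w] at [v], so that no exponent of [z] exceeds that of [w], and the
    equality of the degrees gives [z = w]. *)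
Lemma exchange_up u w z (i v : 'I_m) :
  mdeg w = mdeg u -> mdeg z = mdeg u ->
  (forall j : 'I_m, v < j -> u j = 0) -> (forall j : 'I_m, v < j -> w j = 0) ->
  i < v -> (forall j : 'I_m, i < j -> j < v -> u j = 0) ->
  (forall j, z j = u j - (i == j) + (v == j)) ->
  u v < w v -> (w <= u)%O -> (w <= z)%O.
Proof.
move=> dw dz u0 w0 iv umid zE uv; rewrite le_eqVlt => /orP[/eqP wu|].
  by rewrite wu ltnn in uv.
case/ltmc_diff=> // p [pE plt]; rewrite leNgt; apply/negP.
case/ltmc_diff=> [|q [qE qlt]]; first by rewrite dz.
have pi : p <= i.
  rewrite leqNgt; apply/negP => ip; case: (ltngtP p v) => [pv|vp|/val_inj pv].
  - by rewrite umid in plt.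
  - by rewrite u0 in plt.
  - by rewrite pv in plt; lia.
case: (ltngtP p q) => [pq|qp|/val_inj pq].
- have ip : i = p by apply: val_inj; have := qE p pq; rewrite zE -!val_eqE /=; lia.
  have zw : z = w; last by rewrite zw ltnn in qlt.
  apply: mdeg_eq_le; last by rewrite dz.
  move=> j; case: (ltngtP j q) => [/qE -> //|qj|/val_inj ->]; last exact: ltnW.
  have ij : i < j by rewrite ip (ltn_trans pq).
  rewrite zE; case: (ltngtP j v) => [jv|vj|/val_inj ->].
  + by rewrite (umid j) // -!val_eqE /=; lia.
  + by rewrite u0 // -!val_eqE /=; lia.
  + by rewrite -!val_eqE /= eqxx; lia.
- by have := pE q qp; have := zE q; rewrite -!val_eqE /=; lia.
- by rewrite -pq zE -!val_eqE /= in qlt; lia.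
Qed.

(** The move opposite to [exchange_up], from [v] to its predecessor [i]: a unit
    added at [i] could lift [u] past [w] only if they first differ at [i], by
    one, and then the equality of the degrees forces [z = w]. *)
Lemma exchange_down u w z (i v : 'I_m) :
  mdeg w = mdeg u -> mdeg z = mdeg u ->
  (forall j : 'I_m, v < j -> u j = 0) -> (forall j : 'I_m, v < j -> w j = 0) ->
  v = i.+1 :> nat -> (forall j, z j = u j + (i == j) - (v == j)) ->
  w v < u v -> (u <= w)%O -> (z <= w)%O.
Proof.
move=> dw dz u0 w0 iv zE uv; rewrite le_eqVlt => /orP[/eqP uw|].
  by rewrite uw ltnn in uv.
case/ltmc_diff=> // p [pE plt]; rewrite leNgt; apply/negP.
case/ltmc_diff=> [|q [qE qlt]]; first by rewrite dz.
have pi : p <= i.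
  rewrite leqNgt; apply/negP => ip; case: (ltngtP p v) => [pv|vp|/val_inj pv].
  - lia.
  - by rewrite w0 in plt.
  - by rewrite pv in plt; lia.
case: (ltngtP p q) => [pq|qp|/val_inj pq].
- have ip : i = p by apply: val_inj; have := qE p pq; rewrite zE -!val_eqE /=; lia.
  have zw : w = z; last by rewrite zw ltnn in qlt.
  apply: mdeg_eq_le; last by rewrite dz.
  move=> j; case: (ltngtP j q) => [/qE -> //|qj|/val_inj ->]; last exact: ltnW.
  by rewrite w0 // iv; apply: leq_ltn_trans qj; rewrite ip.
- by have := pE q qp; have := zE q; rewrite -!val_eqE /=; lia.
- by rewrite -pq zE -!val_eqE /= in qlt; lia.
Qed.

End Vectors.

(** * Layers, shadows and initial segments *)

Section Points.
Variables m n : nat.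
Notation point := ('X_{1..m} * 'I_n)%type.
Implicit Types (x y z : point) (A B L : {fset point}) (r d : nat).

Definition raise (i : 'I_m) x : point := ((x.1 + U_(i))%MM, x.2).

(** The order in which a greedy construction fills a degree: copy after copy,
    and lexicographically large vectors first within a copy.  It is meant for
    points of equal degree. *)
Definition before x y : bool :=
  (x.2 < y.2) || ((x.2 == y.2) && (y.1 <= x.1)%O).

Definition in_layer r d x : bool :=
  (mdeg x.1 == d) && [forall i : 'I_m, (r <= i) ==> (x.1 i == 0)].

(** Only the first [r] variables may occur.  This parameter allows inductions on
    the number of variables within a single type of vectors. *)
Definition layer r d : {fset point} :=
  [fset x in [seq (bmnm u, j) | u <- enum {: 'X_{1..m < d.+1}}, j <- enum 'I_n]
   | in_layer r d x].

Definition shadow r A : {fset point} :=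
  [fset raise p.1 p.2 | p in
    [seq (i, x) | i <- [seq i : 'I_m <- enum 'I_m | i < r], x <- enum_fset A]].

Definition initial r d L : Prop :=
  L `<=` layer r d /\
  forall x y, x \in L -> y \in layer r d -> before y x -> y \in L.

Lemma point_eq x y : x.1 =1 y.1 -> x.2 = y.2 -> x = y.
Proof. by case: x y => [x a] [y b] /= /mnmP e1 e2; congr pair. Qed.

Lemma in_layerP r d x :
  reflect (mdeg x.1 = d /\ forall i : 'I_m, r <= i -> x.1 i = 0) (x \in layer r d).
Proof.
have -> : (x \in layer r d) = in_layer r d x.
  rewrite !inE /=; case: (boolP (in_layer r d x)) => inx; rewrite ?andbF // andbT.
  have lt : mdeg x.1 < d.+1 by case/andP: inx => /eqP ->.
  apply/allpairsP; exists (BMultinom lt, x.2); rewrite !mem_enum; split=> //=.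
  exact: surjective_pairing.
apply: (iffP andP) => [[/eqP -> /forallP h]|[-> h]].
  by split=> // i ri; have /implyP/(_ ri)/eqP := h i.
by split=> //; apply/forallP => i; apply/implyP => /h ->.
Qed.

Lemma shadowP r A z :
  reflect (exists (i : 'I_m) x, [/\ i < r, x \in A & z = raise i x]) (z \in shadow r A).
Proof.
rewrite /shadow.
apply: (iffP (imfsetP _ _ _ _)) => [[p /= /allpairsP[q [+ qA ->]] ->]|[i [x [ir xA ->]]]].
  by rewrite mem_filter => /andP[qr _]; exists q.1, q.2.
exists (i, x) => //=; apply/allpairsP; exists (i, x); split=> //=.
by rewrite mem_filter ir mem_enum.
Qed.

Lemma shadow_raise r A (i : 'I_m) x : i < r -> x \in A -> raise i x \in shadow r A.
Proof. by move=> ir xA; apply/shadowP; exists i, x. Qed.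

Lemma raiseE i x j : (raise i x).1 j = x.1 j + (i == j).
Proof. by rewrite mnmDE mnm1E. Qed.

Lemma raise_inj i : injective (raise i).
Proof.
move=> [x a] [y b] e; have [xy ab] := (congr1 fst e, congr1 snd e).
by congr pair => //; exact: addIm xy.
Qed.

Lemma mdeg_raise i x : mdeg (raise i x).1 = (mdeg x.1).+1.
Proof. by rewrite mdegD mdeg1 addn1. Qed.

Lemma raise_layer r d (i : 'I_m) x :
  i < r -> x \in layer r d -> raise i x \in layer r d.+1.
Proof.
move=> ir /in_layerP[dx x0]; apply/in_layerP; split; first by rewrite mdeg_raise dx.
move=> j rj; rewrite raiseE x0 //; case: eqP => // ij.
by move: ir; rewrite ij ltnNge rj.
Qed.

Lemma unraise i x : 0 < x.1 i -> x = raise i ((x.1 - U_(i))%MM, x.2).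
Proof.
move=> xi; case: x xi => x a /= xi; congr pair; apply/mnmP => j.
rewrite mnmDE mnmBE mnm1E; case: eqP => [<-|_]; last by rewrite subn0 addn0.
by rewrite subnK.
Qed.

Lemma raise_layer_inv r d (i : 'I_m) x :
  raise i x \in layer r d.+1 -> x \in layer r d /\ i < r.
Proof.
case/in_layerP; rewrite mdeg_raise => -[dx] h; split.
  apply/in_layerP; split=> // j /h; rewrite raiseE; lia.
by rewrite ltnNge; apply/negP => /h; rewrite raiseE eqxx; lia.
Qed.

Lemma shadow_layer r d A : A `<=` layer r d -> shadow r A `<=` layer r d.+1.
Proof.
move=> /fsubsetP sA; apply/fsubsetP => _ /shadowP[i [x [ir /sA xA ->]]].
exact: raise_layer.
Qed.

Lemma shadowS r A B : A `<=` B -> shadow r A `<=` shadow r B.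
Proof.
move=> /fsubsetP sA; apply/fsubsetP => _ /shadowP[i [x [ir /sA xA ->]]].
exact: shadow_raise.
Qed.

Lemma before_total : total before.
Proof.
by move=> [x a] [y b]; rewrite /before /= -!val_eqE /=; case: ltngtP => //= _; apply: le_total.
Qed.

Lemma before_trans : transitive before.
Proof.
move=> [y b] [x a] [z c]; rewrite /before /= -!val_eqE /=.
case/orP=> [ab|/andP[/eqP -> yx]]; case/orP=> [bc|/andP[/eqP <- zy]].
- by rewrite (ltn_trans ab bc).
- by rewrite ab.
- by rewrite bc.
- by rewrite eqxx (le_trans zy yx) orbT.
Qed.

Lemma before_anti x y : before x y -> before y x -> x = y.
Proof.
case: x y => [x a] [y b]; rewrite /before /= -!val_eqE /=.
case: ltngtP => //= ab yx xy; congr pair; last exact: val_inj.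
by apply: le_anti; rewrite yx xy.
Qed.

Lemma before_raise2 i x y : before (raise i x) (raise i y) = before x y.
Proof. by rewrite /before /= lemc_add2l. Qed.

Lemma before_raise (i j : 'I_m) x : i <= j -> before (raise i x) (raise j x).
Proof.
move=> ij; rewrite /before /= eqxx ltnn /= lemc_add2r.
move: ij; rewrite leq_eqVlt => /orP[/eqP/val_inj -> //|ij].
apply/ltW/ltmcP; first by rewrite !mdeg1.
exists i; first by move=> q qi; rewrite !mnm1E -!val_eqE /=; do 2!case: eqP => //=; lia.
by rewrite !mnm1E eqxx -val_eqE /=; case: eqP => //=; lia.
Qed.

(** The point added is the first one of the layer outside [L]. *)
Lemma initial_next r d L A : initial r d L -> A `<=` layer r d -> #|` L| < #|` A| ->
  exists x, [/\ x \notin L, x \in layer r d, initial r d (x |` L)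
    & forall y, y \in L -> before y x].
Proof.
move=> [sL iL] sA ltLA.
have [x0 x0P] : exists x0, x0 \in layer r d `\` L.
  apply/fset0Pn; apply: contraTneq ltLA => e.
  rewrite -leqNgt; apply: fsubset_leq_card; apply: fsubset_trans sA _.
  by rewrite -fsetD_eq0 e.
have [x] := fset_least before_total before_trans x0P.
rewrite in_fsetD => /andP[xL xG] xmin.
have Lx y : y \in L -> before y x.
  move=> yL; case/orP: (before_total y x) => // xy.
  by case/negP: xL; apply: iL yL xG xy.
exists x; split=> //; split.
  by rewrite fsubUset fsub1set xG.
move=> y z; rewrite !in_fset1U => /orP[/eqP yx|yL] zG zy; last by rewrite (iL y) ?orbT.
rewrite {y}yx in zy.
case: (boolP (z \in L)) => [_|zL]; first by rewrite orbT.
have zD : z \in layer r d `\` L by rewrite in_fsetD zL.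
by rewrite (before_anti zy (xmin _ zD)) eqxx.
Qed.

(** The shadow of an initial segment is again initial because of this: to pass
    from a point [y], placed before a point above [x], to a point below [y] and
    placed before [x], remove one unit of the last variable occurring in [y].
    This is the removal which decreases [y] the least. *)
Lemma before_below r d (i : 'I_m) x y :
  x \in layer r d -> y \in layer r d.+1 -> before y (raise i x) ->
  exists (k : 'I_m) z, [/\ k < r, z \in layer r d, y = raise k z & before z x].
Proof.
move=> xG yG yx; case/in_layerP: (yG) => dy y0.
have [|k yk kmax] := @last_nonzero _ y.1; first by rewrite dy.
have [z yE zj] : exists2 z, y = raise k z & forall j, z.1 j = y.1 j - (k == j).
  exists ((y.1 - U_(k))%MM, y.2); first exact: unraise.
  by move=> j; rewrite mnmBE mnm1E.
have [zG kr] : z \in layer r d /\ k < r by apply: raise_layer_inv; rewrite -yE.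
exists k, z; split=> //.
have z2 : z.2 = y.2 by rewrite yE.
case/orP: yx => [ylt|/andP[/eqP /= e le]]; first by rewrite /before z2 ylt.
(* If [i <= k], raising by [k] is placed after raising by [i], and raising by [k]
   cancels on both sides.  Otherwise the first differences are compared. *)
case: (leqP i k) => [ik|ki].
  have : before y (raise k x).
    by apply: before_trans (before_raise x ik); rewrite /before e eqxx le orbT.
  by rewrite yE before_raise2.
rewrite /before z2 e eqxx ltnn /= leNgt; apply/negP => lt.
have [dx _] := in_layerP _ _ _ xG; have [dz _] := in_layerP _ _ _ zG.
have [|q [qE qlt]] := ltmc_diff _ lt; first by rewrite dz dx.
have qk : q <= k.
  rewrite leqNgt; apply/negP => kq.
  have zx : z.1 = x.1; last by rewrite zx ltnn in qlt.
  apply: mdeg_eq_le; last by rewrite dz dx.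
  move=> j; case: (ltnP k j) => [kj|jk]; first by rewrite zj kmax.
  by rewrite qE //; exact: leq_ltn_trans kq.
move: le; rewrite le_eqVlt => /orP[/eqP/mnmP /(_ i)|].
  by rewrite (kmax i) // mnmDE mnm1E eqxx; lia.
case/ltmc_diff=> [|p [pE plt]]; first by rewrite mdegD mdeg1 dx dy addn1.
have pk : p <= k by rewrite leqNgt; apply/negP => /kmax yp; rewrite yp in plt.
have rE (j : 'I_m) : j <= k -> (x.1 + U_(i))%MM j = x.1 j.
  by move=> jk; rewrite mnmDE mnm1E; case: eqP => [E|_]; [move: ki; rewrite E; lia | lia].
rewrite rE // in plt; have := zj q; have := zj p; rewrite -!val_eqE /=.
case: (ltngtP p q) => [pq|qp|/val_inj pq].
- by rewrite (qE p pq); lia.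
- by have := pE q qp; rewrite rE //; lia.
- by rewrite -pq in qlt *; lia.
Qed.

End Points.

(** * Compression along two-variable lines *)

Section Compression.
Variables m n : nat.
Notation point := ('X_{1..m} * 'I_n)%type.
Local Notation layer := (layer m n).
Implicit Types (x y z t : point) (A B : {fset point}) (r d p : nat).
Variables i v : 'I_m.
Hypothesis iv : i != v.

(** The points with the same copy, the same degree and the same exponents as [x]
    outside [i] and [v] form a line; [slide p x] is its point with exponent [p]
    at [v], and [line x], its point with exponent [0], serves as its name. *)
Definition slide p x : point :=
  ([multinom if j == v then p else
             if j == i then x.1 i + x.1 v - p else x.1 j | j < m], x.2).

Definition line x : point := slide 0 x.

Definition rank A x : nat :=
  #|` [fset y in A | (line y == line x) && (y.1 v < x.1 v)]|.

(** On each line, the points of [A] are replaced by as many points with the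
    smallest exponents at [v].  Moving a point to the position given by its rank
    makes this a bijection under which no exponent at [v] grows. *)
Definition compress A : {fset point} := [fset slide (rank A x) x | x in A].

Lemma slideE p x j : (slide p x).1 j =
  if j == v then p else if j == i then x.1 i + x.1 v - p else x.1 j.
Proof. by rewrite mnmE. Qed.

Lemma slide_line p x : slide p (line x) = slide p x.
Proof.
apply: point_eq => // j; rewrite !slideE !eqxx (negbTE iv).
by case: eqP => // _; case: eqP => // _; lia.
Qed.

Lemma line_slide p x : p <= x.1 i + x.1 v -> line (slide p x) = line x.
Proof.
move=> px; apply: point_eq => // j; rewrite !slideE !eqxx (negbTE iv).
by case: eqP => // _; case: eqP => // _; lia.
Qed.

Lemma slide_id x : slide (x.1 v) x = x.
Proof.
apply: point_eq => // j; rewrite slideE.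
by case: eqP => [-> //|_]; case: eqP => [->|//]; lia.
Qed.

Lemma line_inj x y : line x = line y -> x.1 v = y.1 v -> x = y.
Proof.
by move=> lxy vxy; rewrite -(slide_id x) -(slide_line _ x) lxy slide_line vxy slide_id.
Qed.

Lemma rank_le A x : rank A x <= x.1 v.
Proof.
have -> : x.1 v = #|` [fset k in iota 0 (x.1 v)]|.
  by rewrite card_fseq undup_id ?iota_uniq // size_iota.
apply: (@leq_card_inj _ _ (fun y => y.1 v)) => [y z|y]; rewrite !inE /=; last first.
  by rewrite mem_iota => /and3P[_ _ ->].
by case/and3P=> _ /eqP ly _ /and3P[_ /eqP lz _]; apply: line_inj; rewrite ly lz.
Qed.

(** Adding the gap [z] to [A] increases the rank of [x], which still is at most
    its exponent at [v]. *)
Lemma rank_lt A x z :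
  z \notin A -> line z = line x -> z.1 v < x.1 v -> rank A x < x.1 v.
Proof.
move=> zA lz ltz; apply: leq_trans (rank_le (z |` A) x).
rewrite /rank (_ : [fset y in z |` A | _] =
  z |` [fset y in A | (line y == line x) && (y.1 v < x.1 v)]); last first.
  by apply/fsetP => y; rewrite !inE; case: eqP => [-> /=|]; rewrite // lz eqxx ltz.
by rewrite cardfsU1 !inE (negbTE zA).
Qed.

Lemma rank_mono A x y : x \in A -> line x = line y -> x.1 v < y.1 v ->
  rank A x < rank A y.
Proof.
move=> xA lxy lt; apply: (@ltn_card_witness _ _ _ x).
- apply/fsubsetP => z; rewrite !inE lxy => /and3P[-> -> /= zx].
  exact: ltn_trans lt.
- by rewrite !inE xA lxy eqxx lt.
- by rewrite !inE ltnn !andbF.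
Qed.

Lemma rank_inj A x y : x \in A -> y \in A -> line x = line y ->
  rank A x = rank A y -> x = y.
Proof.
move=> xA yA lxy rxy; apply: line_inj => //.
case: (ltngtP (x.1 v) (y.1 v)) => // lt.
  by have := rank_mono xA lxy lt; rewrite rxy ltnn.
by have := rank_mono yA (esym lxy) lt; rewrite rxy ltnn.
Qed.

Definition fiber A t : {fset point} := [fset y in A | line y == t].

Lemma fiberP A t y : (y \in fiber A t) = (y \in A) && (line y == t).
Proof. by rewrite !inE. Qed.

Lemma rank_lt_fiber A x : x \in A -> rank A x < #|` fiber A (line x)|.
Proof.
move=> xA; apply: (@ltn_card_witness _ _ _ x).
- by apply/fsubsetP => z; rewrite !inE => /and3P[-> -> _].
- by rewrite !inE xA eqxx.
- by rewrite !inE ltnn !andbF.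
Qed.

Lemma rank_surj A t p : p < #|` fiber A t| ->
  exists x, [/\ x \in A, line x = t & rank A x = p].
Proof.
move=> lt; pose s := [seq rank A x | x <- fiber A t].
have us : uniq s.
  rewrite map_inj_in_uniq ?fset_uniq // => x y.
  rewrite !fiberP => /andP[xA /eqP lx] /andP[yA /eqP ly]; apply: rank_inj => //.
  by rewrite lx ly.
have ss : {subset s <= iota 0 #|` fiber A t|}.
  move=> _ /mapP[x + ->]; rewrite fiberP mem_iota => /andP[xA /eqP <-].
  exact: rank_lt_fiber.
have [|_ sE] := uniq_min_size us ss; first by rewrite size_iota size_map.
have : p \in s by rewrite sE mem_iota.
by case/mapP=> x; rewrite fiberP => /andP[xA /eqP lx] ->; exists x.
Qed.

Lemma line_compress A x : line (slide (rank A x) x) = line x.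
Proof. by rewrite line_slide // (leq_trans (rank_le A x)) // leq_addl. Qed.

Lemma compress_inj A : {in A &, injective (fun x => slide (rank A x) x)}.
Proof.
move=> x y xA yA e; apply: (rank_inj xA yA).
  by rewrite -(line_compress A x) e line_compress.
by have := congr1 (fun z => z.1 v) e; rewrite !slideE eqxx.
Qed.

Lemma card_compress A : #|` compress A| = #|` A|.
Proof. by rewrite card_in_imfset //; apply: compress_inj. Qed.

Lemma compressP A z : (z \in compress A) = (z.1 v < #|` fiber A (line z)|).
Proof.
apply/imfsetP/idP => [[x xA ->]|/rank_surj[x [xA lx rx]]].
  by rewrite line_compress slideE eqxx rank_lt_fiber.
by exists x => //=; rewrite rx -slide_line lx slide_line slide_id.
Qed.

Lemma mdeg_slide p x : p <= x.1 i + x.1 v -> mdeg (slide p x).1 = mdeg x.1.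
Proof.
move=> px; rewrite !mdegE (bigD1 v) //= (bigD1 i) //=.
rewrite [RHS](bigD1 v) //= [in RHS](bigD1 i) //= !slideE !eqxx (negbTE iv).
rewrite !addnA; congr (_ + _); first by lia.
by apply: eq_bigr => j /andP[/negbTE jv /negbTE ji]; rewrite slideE jv ji.
Qed.

Lemma compress_layer r d A : i < r -> v < r -> A `<=` layer r d ->
  compress A `<=` layer r d.
Proof.
move=> ir vr /fsubsetP sA; apply/fsubsetP => _ /imfsetP[x /= xA ->].
have [dx x0] := in_layerP _ _ _ (sA _ xA); apply/in_layerP; split.
  by rewrite mdeg_slide // (leq_trans (rank_le A x)) // leq_addl.
move=> j rj; rewrite slideE.
case: eqP => [jv|_]; first by move: vr; rewrite ltnNge -jv rj.
by case: eqP => [ji|_]; [move: ir; rewrite ltnNge -ji rj | apply: x0].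
Qed.

Lemma line_raise (k : 'I_m) x : k != v -> line (raise k x) = raise k (line x).
Proof.
move=> kv; apply: point_eq => // j; rewrite !raiseE !slideE !raiseE.
rewrite (negbTE kv); case: eqP => [->|_]; first by rewrite (negbTE kv).
by case: eqP => [->|_] //; lia.
Qed.

Lemma line_raise_v x : line (raise v x) = raise i (line x).
Proof.
apply: point_eq => // j; rewrite !raiseE !slideE !raiseE eqxx.
rewrite !(eq_sym v) (eq_sym i j) (negbTE iv).
case: (altP (j =P v)) => [->|_]; first by rewrite eq_sym (negbTE iv).
by case: (j == i); rewrite /= ?addn0 ?subn0 ?addnA.
Qed.

(** On a line of the next degree, the compression of [A] contributes the images
    by raising of initial parts of lines, which are nested, so only the largest
    one counts.  Raising by a variable other than [v] embeds a line of [A] in a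
    line of the shadow.  For [v], the raised points of a line of [A] are joined
    by one more, below all of them. *)
Lemma shadow_compress r A : i < r ->
  shadow r (compress A) `<=` compress (shadow r A).
Proof.
move=> ir; apply/fsubsetP => _ /shadowP[k [x [kr + ->]]]; rewrite !compressP => xA.
have raise_fiber (l : 'I_m) : l < r -> (forall y, line (raise l y) = line (raise k y)) ->
    {in fiber A (line x), forall y, raise l y \in fiber (shadow r A) (line (raise k x))}.
  move=> lr lE y; rewrite !fiberP => /andP[yA /eqP ly].
  rewrite shadow_raise //= lE; apply/eqP; case: (altP (k =P v)) => [->|kv].
    by rewrite !line_raise_v ly.
  by rewrite !line_raise // ly.
case: (altP (k =P v)) => [kv|kv].
  have /fset0Pn[x0 x0A] : fiber A (line x) != fset0.
    by rewrite -cardfs_gt0; apply: leq_trans xA.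
  (* The extra point: the lowest point of the line, raised by [i] in place of [v]. *)
  pose le_v y z := y.1 v <= z.1 v.
  have [||y yA ymin] := @fset_least _ le_v _ x0 _ _ x0A.
  - by move=> a b; apply: leq_total.
  - by move=> b a c; apply: leq_trans.
  rewrite raiseE kv eqxx addn1.
  pose B := [fset raise v y | y in fiber A (line x)].
  have cB : #|` B| = #|` fiber A (line x)| by apply: card_imfset; apply: raise_inj.
  have iB : raise i y \notin B.
    apply/imfsetP => -[z /= zA e]; have := ymin z zA; rewrite /le_v.
    have := congr1 (fun t => t.1 v) e; rewrite !raiseE eqxx (negbTE iv); lia.
  rewrite (@leq_trans #|` raise i y |` B|) //.
    by rewrite cardfsU1 iB cB.
  apply: fsubset_leq_card; rewrite fsubUset fsub1set -kv; apply/andP; split.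
    by apply: raise_fiber => // z; rewrite kv line_raise_v line_raise.
  by apply/fsubsetP => _ /imfsetP[z /= zA ->]; rewrite -kv; apply: raise_fiber.
rewrite raiseE (negbTE kv) addn0; apply: leq_trans xA _.
apply: (@leq_card_inj _ _ (raise k)) => [y z _ _|]; first exact: raise_inj.
exact: raise_fiber.
Qed.

(** A gap below a point of [A] makes compression progress; this is what
    terminates the repeated compressions in [stabilise]. *)
Lemma compress_weight A x z : x \in A -> z \notin A -> line z = line x ->
  z.1 v < x.1 v -> \sum_(y <- compress A) y.1 v < \sum_(y <- A) y.1 v.
Proof.
move=> xA zA lz lt; rewrite big_imfset /=; last exact: compress_inj.
rewrite (big_fsetD1 x) //= [X in _ < X](big_fsetD1 x) //= slideE eqxx -addSn.
rewrite leq_add ?(rank_lt zA) //; apply: leq_sum => y _.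
by rewrite slideE eqxx rank_le.
Qed.

End Compression.

(** * Stable sets *)

Section Stabilisation.
Variables m n : nat.
Notation point := ('X_{1..m} * 'I_n)%type.
Local Notation layer := (layer m n).
Implicit Types (x y z t : point) (A B : {fset point}) (r d p : nat).

(** The combinatorial form, restricted to trades with the variable numbered [r],
    of the strongly stable (Borel-fixed) monomial ideals. *)
Definition stable r A : Prop := forall (i v : 'I_m) x,
  i < r -> v = r :> nat -> raise v x \in A -> raise i x \in A.

(** A set which is not stable can be compressed along some line direction with a
    gap, without enlarging its shadow; the total exponent of the last variable
    decreases each time. *)
Lemma stabilise r d A : A `<=` layer r.+1 d -> exists B,
  [/\ B `<=` layer r.+1 d, #|` B| = #|` A|, stable r B
    & #|` shadow r.+1 B| <= #|` shadow r.+1 A|].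
Proof.
have [v vr|no] := pickP (fun v : 'I_m => v == r :> nat); last first.
  move=> sA; exists A; split=> // i v x _ vr; have := no v.
  by rewrite vr eqxx.
have [w] := ubnP (\sum_(y <- A) y.1 v); elim: w A => // w IH A; rewrite ltnS => wA sA.
have [st|nst] := classic (stable r A); first by exists A.
have [i [x [ir xA xnA]]] : exists (i : 'I_m) x,
    [/\ i < r, raise v x \in A & raise i x \notin A].
  apply: NNPP => no; apply: nst => i v' x ir v'r xA.
  have v'E : v' = v by apply: val_inj; rewrite /= v'r (eqP vr).
  by apply/negPn/negP => xnA; apply: no; exists i, x; rewrite -v'E.
have iv : i != v by rewrite -val_eqE /= (eqP vr) neq_ltn ir.
have ir' : i < r.+1 by apply: ltnW.
have vr' : v < r.+1 by rewrite (eqP vr).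
have [||B [sB cB stB shB]] := IH (compress i v A).
- apply: leq_trans wA; apply: (@compress_weight _ _ i v iv A (raise v x) (raise i x)) => //.
    by rewrite line_raise_v // line_raise.
  by rewrite !raiseE eqxx (negbTE iv); lia.
- exact: compress_layer.
exists B; split=> //; first by rewrite cB card_compress.
apply: leq_trans shB _; rewrite -(card_compress iv (shadow r.+1 A)).
exact/fsubset_leq_card/shadow_compress.
Qed.

End Stabilisation.

(** * Slices by the exponent of the last variable *)

Section Slices.
Variables m n : nat.
Notation point := ('X_{1..m} * 'I_n)%type.
Local Notation layer := (layer m n).
Implicit Types (x y z : point) (A B L : {fset point}) (r d k : nat).
Variable v : 'I_m.

Definition lift k x : point := ((x.1 + U_(v) *+ k)%MM, x.2).

(** Setting the exponent at [v] to [0] loses nothing on a slice, where this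
    exponent is constant; [lift k] restores it. *)
Definition forget x : point := ([multinom if j == v then 0 else x.1 j | j < m], x.2).

Definition slice k A : {fset point} := [fset forget x | x in [fset y in A | y.1 v == k]].

Lemma liftE k x j : (lift k x).1 j = x.1 j + (v == j) * k.
Proof. by rewrite mnmDE mulmnE mnm1E. Qed.

Lemma lift0 x : lift 0 x = x.
Proof. by apply: point_eq => // j; rewrite liftE muln0 addn0. Qed.

Lemma liftS k x : lift k.+1 x = raise v (lift k x).
Proof. by apply: point_eq => // j; rewrite raiseE !liftE; lia. Qed.

Lemma lift_raise k (i : 'I_m) x : lift k (raise i x) = raise i (lift k x).
Proof. by apply: point_eq => // j; rewrite raiseE !liftE raiseE; lia. Qed.

Lemma before_lift k x y : before (lift k x) (lift k y) = before x y.
Proof. by elim: k => [|k IH]; rewrite ?lift0 // !liftS before_raise2. Qed.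

Lemma mdeg_lift k x : mdeg (lift k x).1 = mdeg x.1 + k.
Proof. by elim: k => [|k IH]; rewrite ?lift0 ?addn0 // liftS mdeg_raise IH addnS. Qed.

Lemma sliceP k A z : (z \in slice k A) = (z.1 v == 0) && (lift k z \in A).
Proof.
apply/imfsetP/andP => [[x /=]|[/eqP z0 zA]].
  rewrite !inE => /andP[xA /eqP xv] ->; rewrite mnmE !eqxx; split=> //.
  rewrite (_ : lift k _ = x) //; apply: point_eq => // j.
  rewrite liftE mnmE eq_sym; case: eqP => [<-|_]; rewrite ?xv; lia.
exists (lift k z); first by rewrite !inE zA liftE eqxx z0 mul1n /=.
apply: point_eq => // j; rewrite mnmE liftE eq_sym; case: eqP => [<-|_]; rewrite ?z0; lia.
Qed.

Lemma card_slice k A : #|` slice k A| = #|` [fset x in A | x.1 v == k]|.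
Proof.
rewrite card_in_imfset // => x y; rewrite !inE => /andP[_ /eqP xk] /andP[_ /eqP yk] e.
apply: point_eq => [j|]; last exact: (congr1 snd e).
have := congr1 (fun z => z.1 j) e; rewrite !mnmE.
by case: eqP => [->|//]; rewrite xk yk.
Qed.

Variable r : nat.
Hypothesis vr : v = r :> nat.

Lemma layer_coord0 d x : x \in layer r d -> x.1 v = 0.
Proof. by case/in_layerP=> _; apply; rewrite vr. Qed.

Lemma lift_layer d k x : k <= d ->
  (lift k x \in layer r.+1 d) && (x.1 v == 0) = (x \in layer r (d - k)).
Proof.
move=> kd; apply/andP/idP => [[/in_layerP[dx x0] /eqP xv]|xG].
  apply/in_layerP; split=> [|j]; first by rewrite -dx mdeg_lift addnK.
  rewrite leq_eqVlt => /orP[/eqP rj|/x0]; last by rewrite liftE; lia.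
  by rewrite -xv; congr (x.1 _); apply: val_inj; rewrite /= vr.
have [dx x0] := in_layerP _ _ _ xG; rewrite (layer_coord0 xG); split=> //.
apply/in_layerP; split=> [|j rj]; first by rewrite mdeg_lift dx subnK.
rewrite liftE x0 1?ltnW //; case: eqP => // vj.
by move: rj; rewrite -vj vr ltnn.
Qed.

Lemma slice_layer d k A : A `<=` layer r.+1 d -> k <= d -> slice k A `<=` layer r (d - k).
Proof.
move=> /fsubsetP sA kd; apply/fsubsetP => z; rewrite sliceP => /andP[z0 /sA zA].
by rewrite -lift_layer // zA.
Qed.

Lemma initial_stable d L : initial r.+1 d L -> stable r L.
Proof.
move=> [/fsubsetP sL iL] i v' x ir v'r xL; apply: iL (xL) _ _.
  have [dx x0] := in_layerP _ _ _ (sL _ xL); apply/in_layerP; split.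
    by rewrite mdeg_raise -dx mdeg_raise.
  move=> j rj; rewrite raiseE; have := x0 j rj; rewrite raiseE.
  by case: (i =P j) => [ij|_]; [move: rj; rewrite -ij; lia | lia].
by apply: before_raise; rewrite v'r ltnW.
Qed.

Lemma initial_slice d k L : initial r.+1 d L -> k <= d -> initial r (d - k) (slice k L).
Proof.
move=> [sL iL] kd; split; first exact: slice_layer.
move=> x y; rewrite !sliceP => /andP[_ xL]; rewrite -lift_layer // => /andP[yG y0] yx.
by rewrite y0 (iL _ _ xL yG) // before_lift.
Qed.

(** Raising a point of the slice [k.+1] by an earlier variable amounts, after
    lifting, to trading one unit of [v] for that variable. *)
Lemma shadow_slice k A : stable r A -> shadow r (slice k.+1 A) `<=` slice k A.
Proof.
move=> stA; apply/fsubsetP => _ /shadowP[i [x [ir + ->]]].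
rewrite !sliceP liftS raiseE lift_raise => /andP[/eqP -> xA]; rewrite (stA _ v) // andbT.
by rewrite add0n -val_eqE /= vr (ltn_eqF ir).
Qed.

Lemma shadow_slice_coord0 k A z : z \in shadow r (slice k A) -> z.1 v = 0.
Proof.
case/shadowP=> i [x [ir + ->]]; rewrite sliceP => /andP[/eqP xv _].
by rewrite raiseE xv -val_eqE /= vr (ltn_eqF ir).
Qed.

(** The two parts are told apart by the exponent at [v], which is positive in the
    first and zero in the second. *)
Lemma card_shadow_split A :
  #|` (raise v @` A) `|` shadow r (slice 0 A)| = #|` A| + #|` shadow r (slice 0 A)|.
Proof.
rewrite cardfsU (_ : _ `&` _ = fset0) ?cardfs0 ?subn0; last first.
  apply/fsetP => z; rewrite !inE; apply/negP => /andP[/imfsetP[x /= _ ->]].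
  by move/shadow_slice_coord0; rewrite raiseE eqxx addn1.
by congr (_ + _); apply: card_imfset; apply: raise_inj.
Qed.

Lemma shadow_split_sub A :
  (raise v @` A) `|` shadow r (slice 0 A) `<=` shadow r.+1 A.
Proof.
rewrite fsubUset; apply/andP; split; apply/fsubsetP => z.
  by case/imfsetP=> x /= xA ->; apply: shadow_raise => //; rewrite vr.
case/shadowP=> i [x [ir + ->]]; rewrite sliceP lift0 => /andP[_ xA].
by apply: shadow_raise => //; apply: ltnW.
Qed.

(** If [v] occurs in [x], then raising [x] by an earlier variable is the same as
    trading one unit of [v] for that variable and then raising by [v]. *)
Lemma shadow_split_stable A : stable r A ->
  shadow r.+1 A `<=` (raise v @` A) `|` shadow r (slice 0 A).
Proof.
move=> stA; apply/fsubsetP => _ /shadowP[i [x [+ xA ->]]].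
rewrite in_fsetU ltnS leq_eqVlt => /orP[/eqP ir|ir].
  by rewrite (_ : i = v) ?in_imfset //; apply: val_inj; rewrite /= vr.
case: (posnP (x.1 v)) => [xv|xv]; apply/orP; [right|left].
  by apply: shadow_raise => //; rewrite sliceP xv lift0.
have xE := unraise xv; set y := (_, _) in xE.
rewrite xE (_ : raise i (raise v y) = raise v (raise i y)); last first.
  by apply: point_eq => // j; rewrite !raiseE addnAC.
by rewrite in_imfset //=; apply: (stA _ v) => //; rewrite -xE.
Qed.

End Slices.

(** * Initial segments have the smallest shadows *)

Section Macaulay.
Variables m n : nat.
Notation point := ('X_{1..m} * 'I_n)%type.
Local Notation layer := (layer m n).
Implicit Types (x y z : point) (A B L : {fset point}) (r d k : nat).

Lemma initial_shadow r d L : initial r d L -> initial r d.+1 (shadow r L).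
Proof.
move=> [sL iL]; split; first exact: shadow_layer.
move=> _ y /shadowP[i [x [ir xL ->]]] yG yx.
have [k [z [kr zG -> zx]]] := before_below (fsubsetP sL _ xL) yG yx.
by apply: shadow_raise => //; apply: iL xL zG zx.
Qed.

Lemma initial_last r d L : initial r d L -> L != fset0 -> exists x,
  [/\ x \in L, forall y, y \in L -> before y x,
      forall y, y \in layer r d -> (y \in L) = before y x
    & initial r d (L `\ x)].
Proof.
move=> [sL iL] /fset0Pn[x0 x0L].
pose after x y := before y x.
have [||x xL xmax] := @fset_least _ after L x0 _ _ x0L.
- by move=> y z; apply: before_total.
- by move=> y x z yx zy; apply: before_trans zy yx.
exists x; split=> //.
  by move=> y yG; apply/idP/idP => [/xmax //|yx]; apply: iL xL yG yx.
split; first by apply: fsubset_trans sL; apply: fsubD1set.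
move=> y z; rewrite !in_fsetD1 => /andP[yx yL] zG zy.
rewrite (iL y) // andbT; apply: contraNneq yx => zx.
by rewrite (before_anti (xmax _ yL)) // -zx.
Qed.

Section LastExponent.
Variables (r d : nat) (v : 'I_m) (x0 : point).
Hypotheses (vr : v = r :> nat) (x0G : x0 \in layer r.+1 d).

Lemma above_zero (q : 'I_m) x : x \in layer r.+1 d -> v < q -> x.1 q = 0.
Proof. by case/in_layerP=> _ h vq; apply: h; rewrite -vr. Qed.

(** For [k] less than the exponent of [x0] at [v], where [x0] is the last point of
    an initial segment: the slice [k] of this segment is contained in the shadow
    of its slice [k.+1]. *)
Lemma before_exchange_up x k : k < x0.1 v -> x.1 v = 0 -> lift v k x \in layer r.+1 d ->
  before (lift v k x) x0 ->
  exists (i : 'I_m) y, [/\ i < r, x = raise i y & before (lift v k.+1 y) x0].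
Proof.
move=> kx0 xv xG bx.
have [d0 _] := in_layerP _ _ _ x0G; have [dx _] := in_layerP _ _ _ xG.
have x0d : x0.1 v <= d by rewrite -d0 mdegE (bigD1 v) //= leq_addr.
have [|i xi imax] := @last_nonzero _ x.1.
  by have := mdeg_lift v k x; rewrite dx; lia.
have iv : i < v.
  case: (ltngtP i v) => // [vi|/val_inj iv]; last by rewrite iv xv in xi.
  by have := above_zero xG vi; rewrite liftE; lia.
have [y yE yj] : exists2 y, x = raise i y & forall j, y.1 j = x.1 j - (i == j).
  exists ((x.1 - U_(i))%MM, x.2); first exact: unraise.
  by move=> j; rewrite mnmBE mnm1E.
exists i, y; split=> //; first by rewrite -vr.
have y2 : y.2 = x.2 by rewrite yE.
move: bx; rewrite /before /= y2; case/orP=> [-> //|/andP[x2 le]].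
apply/orP; right; apply/andP; split=> //; apply: (exchange_up _ _ _ _ iv _ _ _ le).
- by rewrite d0 dx.
- by rewrite !mdeg_lift yE mdeg_raise addSn addnS.
- by move=> j; apply: above_zero xG.
- by move=> j; apply: above_zero x0G.
- move=> j ij jv; rewrite liftE imax // -val_eqE /=; lia.
- by move=> j; rewrite !liftE yj -!val_eqE /=; lia.
- by rewrite liftE xv eqxx mul1n.
Qed.

(** For [k] at least the exponent of [x0] at [v]: a point of the slice [k.+1]
    placed after [x0] has, in the slice [k], a point above it which is still not
    placed before [x0]. *)
Lemma before_exchange_down x k : x0.1 v < k.+1 -> x.1 v = 0 ->
  lift v k.+1 x \in layer r.+1 d -> before x0 (lift v k.+1 x) ->
  exists i : 'I_m, i < r /\ before x0 (lift v k (raise i x)).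
Proof.
move=> x0k xv xG bx.
have [d0 x0z] := in_layerP _ _ _ x0G; have [dx xz] := in_layerP _ _ _ xG.
(* If [v] were the first variable, the degree would determine its exponent. *)
have r0 : 0 < r.
  rewrite lt0n; apply/eqP => r0.
  suff e : x0.1 = (lift v k.+1 x).1.
    by move: x0k; rewrite e liftE xv eqxx mul1n ltnn.
  apply: mdeg_eq_le; last by rewrite d0 dx.
  move=> j; case: (altP (j =P v)) => [->|jv].
    by rewrite liftE xv eqxx mul1n ltnW.
  by rewrite x0z //; move: jv; rewrite -val_eqE /= vr r0; lia.
have rm : r.-1 < m by have := ltn_ord v; rewrite vr; lia.
exists (Ordinal rm); split; first by rewrite /= prednK.
move: bx; rewrite /before; case/orP=> [|/andP[x2 le]]; first by move=> ->.
apply/orP; right; apply/andP; split=> //.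
apply: (@exchange_down _ _ _ _ (Ordinal rm) _ _ _ _ _ _ _ _ le).
- by rewrite d0 dx.
- by rewrite !mdeg_lift mdeg_raise addSn addnS.
- by move=> j; apply: above_zero xG.
- by move=> j; apply: above_zero x0G.
- by rewrite vr /= prednK.
- by move=> j; rewrite !liftE raiseE -!val_eqE /=; lia.
- by rewrite liftE xv eqxx mul1n.
Qed.

End LastExponent.

(** Macaulay's theorem on the growth of monomial ideals, for several copies of the
    set of monomials.  After stabilisation, the shadow of a set consists of a
    copy of the set and the shadow of its slice [0], so that it suffices to show
    that the slice [0] of [A] is at least as large as that of [L].  Let [x0] be
    the last point of [L] and [k0] its exponent at [v].  Since [A] has more points
    than [L] without [x0], so has one of its slices.  This excess is transported
    from each slice [k.+1] to the slice [k], since the latter contains the shadow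
    of the former and the induction hypothesis bounds this shadow from below.
    Down to [k0] the excess is over the slices of [L] without [x0]; at [k0] this
    means that the slice of [A] is at least as large as that of [L] itself, and
    this weaker comparison is then transported down to the slice [0]. *)
Theorem macaulay r d A L : r <= m -> A `<=` layer r d -> initial r d L ->
  #|` L| <= #|` A| -> #|` shadow r L| <= #|` shadow r A|.
Proof.
elim: r d A L => [|r IH] d A L rm sA iL LA.
  rewrite (_ : shadow 0 L = fset0) ?cardfs0 //; apply/fsetP => z; rewrite inE.
  by apply/negP => /shadowP[i [x []]].
have [B [sB cB stB shB]] := stabilise sA; apply: leq_trans shB.
rewrite -cB in LA; move: B {A sA cB} sB LA stB => A sA LA stA.
pose v := Ordinal rm; have vr : v = r :> nat by [].
have stL := initial_stable vr iL.
apply: leq_trans (fsubset_leq_card (shadow_split_stable vr stL)) _.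
apply: leq_trans (fsubset_leq_card (shadow_split_sub vr A)).
rewrite !card_shadow_split //; apply: leq_add => //.
have IHk k B (M : {fset point}) : k <= d -> B `<=` layer r (d - k) -> initial r (d - k) M ->
    #|` M| <= #|` B| -> #|` shadow r M| <= #|` shadow r B|.
  by move=> kd; apply: IH; apply: ltnW.
apply: (IHk 0) => //; [exact: slice_layer|exact: initial_slice|].
have [->|L0] := eqVneq L fset0.
  rewrite (_ : slice v 0 fset0 = fset0) ?cardfs0 //; apply/fsetP => z.
  by rewrite sliceP !inE andbF.
have [x0 [x0L x0max LE iL0]] := initial_last iL L0.
have x0G := fsubsetP iL.1 _ x0L.
have x0d : x0.1 v <= d.
  by have [<- _] := in_layerP _ _ _ x0G; rewrite mdegE (bigD1 v) //= leq_addr.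
set L' := L `\ x0 in iL0.
(* Here the slice [k] of [L] lies in the shadow of its slice [k.+1]. *)
have weak k : k < x0.1 v -> #|` slice v k.+1 L| <= #|` slice v k.+1 A| ->
    #|` slice v k L| <= #|` slice v k A|.
  move=> kx0 le; have kd : k.+1 <= d by apply: leq_trans x0d.
  apply: leq_trans (fsubset_leq_card (shadow_slice vr k stA)).
  apply: leq_trans (IHk k.+1 _ _ kd (slice_layer vr sA kd) (initial_slice vr iL kd) le).
  apply: fsubset_leq_card; apply/fsubsetP => z; rewrite sliceP => /andP[/eqP z0 zL].
  have zG := fsubsetP iL.1 _ zL.
  have [|i [y [ir zE yx0]]] := before_exchange_up vr x0G kx0 z0 zG.
    by rewrite -LE.
  rewrite zE; apply: shadow_raise => //.
  have y0 : y.1 v = 0.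
    by apply/eqP; move: z0; rewrite zE raiseE => /eqP; rewrite addn_eq0 => /andP[].
  rewrite sliceP y0 LE //=.
  have : z \in layer r (d - k) by rewrite -(lift_layer vr) ?z0 ?zG // ltnW.
  rewrite zE -(subnSK kd) => /raise_layer_inv[yG _]; move: yG.
  by rewrite -(lift_layer vr) // => /andP[].
(* Here the slice [k.+1] is enlarged by its next point: the shadow of the enlarged
   slice contains the whole slice [k] and one point more. *)
have strict k : x0.1 v < k.+1 -> k < d -> #|` slice v k.+1 L'| < #|` slice v k.+1 A| ->
    #|` slice v k L'| < #|` slice v k A|.
  move=> x0k kd lt.
  have [x [xL' xG ix xmax]] := initial_next (initial_slice vr iL0 kd) (slice_layer vr sA kd) lt.
  have [xG' /eqP xv] : lift v k.+1 x \in layer r.+1 d /\ x.1 v == 0.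
    by apply/andP; rewrite lift_layer.
  have xneq : lift v k.+1 x != x0.
    by apply/eqP => e; move: x0k; rewrite -e liftE xv eqxx mul1n ltnn.
  have xL : lift v k.+1 x \notin L.
    by apply: contra xL' => xL; rewrite sliceP xv in_fsetD1 xneq.
  have x0x : before x0 (lift v k.+1 x).
    by case/orP: (before_total x0 (lift v k.+1 x)) => //; rewrite -LE // (negbTE xL).
  have [i [ir bi]] := before_exchange_down vr x0G x0k xv xG' x0x.
  apply: leq_trans (fsubset_leq_card (shadow_slice vr k stA)).
  have cx : #|` x |` slice v k.+1 L'| <= #|` slice v k.+1 A| by rewrite cardfsU1 xL'.
  apply: leq_trans (IHk k.+1 _ _ kd (slice_layer vr sA kd) ix cx).
  have rxS : raise i x \in shadow r (x |` slice v k.+1 L').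
    by apply: shadow_raise; rewrite ?in_fset1U ?eqxx.
  have rxL' : raise i x \notin slice v k L'.
    rewrite sliceP; apply/negP => /andP[_]; rewrite in_fsetD1 => /andP[/negP ne lL].
    by apply: ne; apply/eqP; apply: before_anti => //; apply: x0max.
  apply: (ltn_card_witness _ rxS rxL').
  have [sS iS] := initial_shadow ix.
  have iLk := initial_slice vr iL0 (ltnW kd).
  apply/fsubsetP => z zL'; have zG := fsubsetP iLk.1 _ zL'.
  apply: (iS _ _ rxS); first by rewrite subnSK.
  case/orP: (before_total z (raise i x)) => // bz.
  case/negP: rxL'; apply: (iLk.2 z) => //.
  have := fsubsetP sS _ rxS; by rewrite subnSK.
(* [A] has more points than [L'], hence more in some slice. *)
have [k kd ltk] : exists2 k, k <= d & #|` slice v k L'| < #|` slice v k A|.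
  apply: NNPP => no.
  have : #|` A| <= #|` L'|.
    apply: (@leq_card_fibers _ (fun x => x.1 v)) => k; rewrite -!card_slice.
    case: (leqP k d) => kd.
      by rewrite leqNgt; apply/negP => lt; apply: no; exists k.
    rewrite (_ : slice v k A = fset0) ?cardfs0 //; apply/fsetP => z.
    rewrite sliceP inE; apply/negP => /andP[_ /(fsubsetP sA) /in_layerP[dz _]].
    by move: kd; rewrite -dz mdeg_lift; lia.
  by apply/negP; move: LA; rewrite (cardfsD1 x0 L) x0L add1n ltnNge.
(* The slices of [L] and [L'] differ only at the exponent of [x0], by one point. *)
have [k' k'x0 lek'] : exists2 k, k <= x0.1 v & #|` slice v k L| <= #|` slice v k A|.
  have sliceL' j : j != x0.1 v -> slice v j L' = slice v j L.
    move=> jx0; apply/fsetP => z; rewrite !sliceP in_fsetD1.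
    case: (z.1 v =P 0) => //= z0; case: eqP => // e.
    by move: jx0; rewrite -e liftE z0 eqxx mul1n eqxx.
  have sliceD : #|` slice v (x0.1 v) L| = #|` slice v (x0.1 v) L'|.+1.
    rewrite !card_slice (cardfsD1 x0) !inE x0L eqxx /= add1n; congr _.+1.
    by congr #|` _|; apply/fsetP => z; rewrite !inE; case: (z == x0); rewrite //= ?andbF.
  case: (ltnP k (x0.1 v)) => [lt|ge].
    exists k; first exact: ltnW.
    have <- : slice v k L' = slice v k L by apply: sliceL'; rewrite neq_ltn lt.
    exact: ltnW.
  exists (x0.1 v) => //; rewrite sliceD.
  elim: k ge kd ltk => [|k IHj]; first by rewrite leqn0 => /eqP <-.
  rewrite leq_eqVlt => /orP[/eqP -> //|ltk] kd ltA.
  by apply: IHj => //; [exact: ltnW | exact: strict].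
elim: k' k'x0 lek' => // k' IHk' k'x0 lek'.
by apply: IHk'; [exact: ltnW | exact: weak].
Qed.

End Macaulay.

(** * Multiples of an antichain, degree by degree *)

Section Ideals.
Variables m n : nat.
Notation point := ('X_{1..m} * 'I_n)%type.
Local Notation layer := (layer m n).
Implicit Types (a b x y z : point) (A B L : {fset point}) (d e : nat).
Implicit Types s t : seq point.

(** Each point added to an initial segment adds a point to its shadow, namely
    itself raised by the last variable, which is placed after the whole shadow
    of the segment. *)
Lemma macaulay_excess d e A L : 0 < m -> A `<=` layer m d -> initial m d L ->
  #|` L| + e <= #|` A| -> #|` shadow m L| + e <= #|` shadow m A|.
Proof.
move=> m0 sA; elim: e L => [|e IH] L iL.
  by rewrite !addn0; apply: macaulay sA iL.
rewrite !addnS => lt; have ltLA : #|` L| < #|` A| by apply: leq_trans lt; rewrite ltnS leq_addr.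
have [x [xL xG ix xmax]] := initial_next iL sA ltLA.
have := IH _ ix; rewrite cardfsU1 xL add1n addSn => /(_ lt); apply: leq_trans.
rewrite -addSn leq_add2r.
have m1 : m.-1 < m by rewrite prednK.
apply: (@ltn_card_witness _ _ _ (raise (Ordinal m1) x)).
- by apply: shadowS; apply: fsubsetU1.
- by apply: shadow_raise; rewrite // fset1U1.
apply/shadowP => -[i [y [_ yL e1]]]; move: xL; rewrite (_ : x = y) ?yL //.
apply: (@raise_inj _ _ i); apply: before_anti; last by rewrite before_raise2 xmax.
by rewrite -e1; apply: before_raise; rewrite /= -ltnS prednK.
Qed.

Definition divided s x : bool := has (fun a => pt_le a x) s.

Definition ideal s d : {fset point} := [fset x in layer m d | divided s x].

Definition gens s d : {fset point} := [fset x in s | pt_deg x == d].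

Lemma layerP d x : (x \in layer m d) = (pt_deg x == d).
Proof.
apply/in_layerP/eqP => [[]//|dx]; split=> // i.
by rewrite leqNgt ltn_ord.
Qed.

Lemma idealP s d x : (x \in ideal s d) = (pt_deg x == d) && divided s x.
Proof. by rewrite [LHS]in_fset [LHS]/= inE /= layerP. Qed.

Lemma gensP s d x : (x \in gens s d) = (x \in s) && (pt_deg x == d).
Proof. by rewrite [LHS]in_fset. Qed.

Lemma pt_le_raise i a x : pt_le a x -> pt_le a (raise i x).
Proof. by case/andP=> a2 le; rewrite /pt_le a2 /=; apply: lepm_trans le (lem_addr _ _). Qed.

Lemma pt_le_deg a x : pt_le a x -> pt_deg a = pt_deg x -> a = x.
Proof.
case: a x => [a j] [x k] /andP[/eqP /= -> /mnm_lepP le] dax.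
by congr pair; apply: mdeg_eq_le.
Qed.

Lemma pt_lexx x : pt_le x x.
Proof. by rewrite /pt_le eqxx lepm_refl. Qed.

Lemma pt_le_split a x : pt_le a x -> a = x \/ exists i y, x = raise i y /\ pt_le a y.
Proof.
move=> ax; case/andP: (ax) => a2 /mnm_lepP le.
case: (pickP (fun i => a.1 i < x.1 i)) => [i lt|no].
  right; exists i, ((x.1 - U_(i))%MM, x.2); split.
    by apply: unraise; apply: leq_ltn_trans lt.
  rewrite /pt_le a2 /=; apply/mnm_lepP => j; rewrite mnmBE mnm1E.
  by case: eqP => [<-|_]; [lia | rewrite subn0].
left; apply: pt_le_deg => //; congr mdeg; apply/mnmP => i; apply/eqP.
by rewrite eqn_leq le leqNgt no.
Qed.

Lemma ideal0 s : ideal s 0 = gens s 0.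
Proof.
apply/fsetP => x; rewrite idealP gensP andbC; case: eqP => [dx|]; rewrite ?andbF // !andbT.
apply/hasP/idP => [[a aS ax]|xs]; last by exists x; rewrite ?pt_lexx.
rewrite -(pt_le_deg ax) // dx; apply/eqP; rewrite -leqn0 -dx.
by case/andP: ax => _ /mnm_lepP le; rewrite /pt_deg !mdegE; apply: leq_sum => i _.
Qed.

Lemma idealS s d : ideal s d.+1 = shadow m (ideal s d) `|` gens s d.+1.
Proof.
apply/fsetP => x; rewrite in_fsetU idealP gensP; apply/andP/orP.
  case=> /eqP dx /hasP[a aS ax]; have [ae|[i [y [xE ay]]]] := pt_le_split ax.
    by right; rewrite -ae aS ae dx eqxx.
  left; rewrite xE; apply: shadow_raise => //; rewrite idealP -eqSS -dx xE.
  by rewrite {2}/pt_deg mdeg_raise eqxx; apply/hasP; exists a.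
case=> [/shadowP[i [y [_ + ->]]]|/andP[xs ->]].
  rewrite idealP => /andP[/eqP <- /hasP[a aS ay]]; rewrite {1}/pt_deg mdeg_raise; split=> //.
  by apply/hasP; exists a => //; apply: pt_le_raise.
by split=> //; apply/hasP; exists x => //; apply: pt_lexx.
Qed.

Lemma antichainP s :
  antichain_seq s <-> uniq s /\ {in s &, forall a b, pt_le a b -> a = b}.
Proof.
split=> [anti|[us le] i j ij].
  have H (x0 : point) i j : i < size s -> j < size s ->
      pt_le (nth x0 s i) (nth x0 s j) -> i = j.
    move=> si sj le; apply/eqP; apply: contraLR le => ij.
    have := anti (Ordinal si) (Ordinal sj).
    by rewrite !(tnth_nth x0) /=; apply; rewrite -val_eqE.
  split=> [|a b aS bS ab].
    case: s anti H => // x0 s _ H; apply/(uniqP x0) => i j; rewrite !inE => si sj e.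
    by apply: (H x0); rewrite // e pt_lexx.
  rewrite -(nth_index a aS) -(nth_index a bS); congr nth.
  by apply: (H a); rewrite ?index_mem // !nth_index.
apply: contra ij => /le e; rewrite -val_eqE /=.
have x0 := tnth (in_tuple s) i.
have {e} := e (mem_tnth _ _) (mem_tnth _ _); rewrite !(tnth_nth x0) => /eqP.
by rewrite nth_uniq.
Qed.

Lemma card_gens_le s d : #|` gens s d| <= count (fun a => pt_deg a == d) s.
Proof.
rewrite -size_filter; apply: leq_trans (size_undup _).
rewrite -card_fseq; apply: fsubset_leq_card; apply/fsubsetP => x.
by rewrite gensP !inE mem_filter andbC.
Qed.

Lemma card_gens s d : uniq s -> #|` gens s d| = count (fun a => pt_deg a == d) s.
Proof.
move=> us; rewrite -size_filter -[filter _ _]undup_id ?filter_uniq // -card_fseq.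
by congr #|` _|; apply/fsetP => x; rewrite gensP !inE mem_filter andbC.
Qed.

Lemma card_idealS_le s d :
  #|` ideal s d.+1| <= #|` shadow m (ideal s d)| + count (fun a => pt_deg a == d.+1) s.
Proof.
rewrite idealS cardfsU; apply: leq_trans (leq_subr _ _) _.
by rewrite leq_add2l card_gens_le.
Qed.

(** For an antichain the new elements of degree [d.+1] are outside the shadow,
    being multiples of no other element. *)
Lemma card_idealS s d : antichain_seq s ->
  #|` ideal s d.+1| = #|` shadow m (ideal s d)| + count (fun a => pt_deg a == d.+1) s.
Proof.
move=> /antichainP[us anti]; rewrite idealS cardfsU (_ : _ `&` _ = fset0).
  by rewrite cardfs0 subn0 card_gens.
apply/fsetP => x; rewrite in_fsetI gensP in_fset0; apply/negP.
case/andP=> /shadowP[i [y [_ + xE]]] /andP[xs _].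
rewrite idealP => /andP[_ /hasP[a aS ay]].
have ax : a = x by apply: anti aS xs _; rewrite xE; apply: pt_le_raise.
move: ay; rewrite ax => /andP[_]; move=> /mnm_lepP/(_ i); rewrite xE raiseE eqxx; lia.
Qed.

Definition low_count d s : nat := count (fun a => pt_deg a <= d) s.

Lemma low_countS d s :
  low_count d.+1 s = low_count d s + count (fun a => pt_deg a == d.+1) s.
Proof.
rewrite /low_count -count_predUI [X in _ + X](_ : _ = 0) ?addn0.
  by apply: eq_count => a /=; rewrite leq_eqVlt ltnS orbC.
by rewrite -[RHS](count_pred0 s); apply: eq_count => a /=; lia.
Qed.

(** When passing to the next degree, the ideal of [t] gains at most its new
    generators and that of the antichain [s] gains all of its own, while the
    existing excess survives in the shadows by [macaulay_excess]. *)
Lemma ideal_excess s t : 0 < m -> antichain_seq s ->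
  (forall d, initial m d (ideal t d)) ->
  (forall d, low_count d t <= low_count d s) ->
  forall d, #|` ideal t d| + (low_count d s - low_count d t) <= #|` ideal s d|.
Proof.
move=> m0 anti it ts; elim=> [|d IH].
  have [us _] := (antichainP s).1 anti.
  have low0 u : low_count 0 u = count (fun a => pt_deg a == 0) u.
    by apply: eq_count => a /=; rewrite leqn0.
  rewrite !ideal0 (card_gens _ us); have := card_gens_le t 0; have := ts 0.
  by rewrite !low0; lia.
rewrite (card_idealS _ anti) !low_countS.
have := card_idealS_le t d.
have sI : ideal s d `<=` layer m d.
  by apply/fsubsetP => x; rewrite idealP layerP => /andP[].
have := macaulay_excess m0 sI (it d) IH; have := ts d; have := ts d.+1.
rewrite !low_countS; lia.
Qed.

(** The shadow of an initial segment is initial, so only the points placed before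
    a new generator have to be examined. *)
Lemma initial_ideal t :
  (forall x y, x \in t -> pt_deg y = pt_deg x -> before y x -> divided t y) ->
  forall d, initial m d (ideal t d).
Proof.
move=> ht; have iG d x y : x \in gens t d -> y \in layer m d -> before y x -> y \in ideal t d.
  rewrite gensP layerP idealP => /andP[xt /eqP dx] /eqP dy yx.
  by rewrite dy eqxx (ht x) // dx.
have sub d : ideal t d `<=` layer m d.
  by apply/fsubsetP => x; rewrite idealP layerP => /andP[].
elim=> [|d IH]; split=> // x y; first by rewrite {1}ideal0; apply: iG.
rewrite {1}idealS in_fsetU => /orP[xS yG yx|]; last exact: iG.
by rewrite idealS in_fsetU ((initial_shadow IH).2 x).
Qed.

End Ideals.

(** * The greedy sequence in one copy *)

Section Greedy.
Variables (m : nat) (h : nat -> nat).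
Hypothesis h_incr : {homo h : i j / i <= j}.
Local Notation g := (greedy m h).
Implicit Types x y : 'X_{1..m}.

Lemma mdeg_greedy i : i < size g -> mdeg (nth 0%MM g i) = h i.+1.
Proof. by case/(greedyP _ h).1 => /andP[/eqP]. Qed.

Lemma greedy_nle i j : i < j -> j < size g -> ~~ (nth 0%MM g i <= nth 0%MM g j)%MM.
Proof.
move=> ij js; have [/andP[_ /allP]] := (greedyP _ h).1 j js; move=> /[swap] _; apply.
by rewrite -(nth_take _ ij) mem_nth // size_take js.
Qed.

Lemma greedy_uniq : uniq g.
Proof.
apply/(uniqP 0%MM) => i j; rewrite !inE => ig jg e.
case: (ltngtP i j) => // lt.
  by have := greedy_nle lt jg; rewrite e lepm_refl.
by have := greedy_nle lt ig; rewrite e lepm_refl.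
Qed.

Lemma greedy_antichain : {in g &, forall x y, (x <= y)%MM -> x = y}.
Proof.
move=> _ _ /(nthP 0%MM)[i ig <-] /(nthP 0%MM)[j jg <-] le.
case: (ltngtP i j) => [ij|ji|-> //]; first by have := greedy_nle ij jg; rewrite le.
apply: mdeg_eq_le; first exact/mnm_lepP.
apply/eqP; rewrite eqn_leq; apply/andP; split.
  by rewrite !mdegE; apply: leq_sum => k _; apply: (mnm_lepP le).
by rewrite !mdeg_greedy // h_incr // ltnW.
Qed.

(** When [x] was chosen, [y] either was already a multiple of a chosen vector, or
    was a candidate; as the choice is the largest candidate, it then equals [y]. *)
Lemma greedy_above x y : x \in g -> mdeg y = mdeg x -> (x <= y)%O ->
  exists2 z, z \in g & (z <= y)%MM.
Proof.
move=> /(nthP 0%MM)[i ig <-] dy xy.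
have [_ gmax] := (greedyP _ h).1 i ig.
have [cy|] := boolP (candidate (h i.+1) (take i g) y).
  exists (nth 0%MM g i); first exact: mem_nth.
  by rewrite (_ : nth _ _ _ = y) ?lepm_refl //; apply: le_anti; rewrite xy gmax.
rewrite /candidate dy mdeg_greedy // eqxx /= -has_predC => /hasP[z /mem_take zg /= le].
by exists z; rewrite // -[(_ <= _)%MM]negbK.
Qed.

Lemma divisor_of_degree y d : d <= mdeg y -> exists2 x, mdeg x = d & (x <= y)%MM.
Proof.
move=> dy; rewrite -(subKn dy); elim: (mdeg y - d) (leq_subr d (mdeg y)) => [|k IH] kd.
  by exists y; rewrite ?subn0 ?lepm_refl.
have [x dx xy] := IH (ltnW kd).
have [|i xi] := @mdeg_pos _ x; first by rewrite dx subn_gt0.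
exists (x - U_(i))%MM; last by apply: lepm_trans xy; apply: lem_subr.
by rewrite subnS -dx -{2}(@submK _ U_(i) x) ?lep1mP -?lt0n // mdegD mdeg1 addn1.
Qed.

(** The sequence stopped because every vector of the degree [h (size g).+1] is a
    multiple of a chosen one, and [y] is a multiple of a vector of that degree. *)
Lemma greedy_full y : h (size g).+1 <= mdeg y -> exists2 z, z \in g & (z <= y)%MM.
Proof.
case/divisor_of_degree=> x dx xy; have := (greedyP _ h).2 x.
rewrite /candidate dx eqxx /= -has_predC => /hasP[z zg /= le].
by exists z => //; apply: lepm_trans xy; rewrite -[(_ <= _)%MM]negbK.
Qed.

End Greedy.

(** * The concatenated greedy sequence *)

Section Concat.
Variables (m n : nat) (f : nat -> nat).
Hypothesis f_incr : {homo f : i j / i <= j}.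
Notation point := ('X_{1..m} * 'I_n)%type.
Implicit Types x y : point.
Local Notation t := (greedy_concat m n f).
Local Notation start := (block_start m f).

Lemma block_fun_incr j : {homo block_fun m f j : i k / i <= k}.
Proof. by move=> i k ik; rewrite /block_fun f_incr // leq_add2r. Qed.

Lemma mem_concat x : (x \in t) = (x.1 \in greedy m (block_fun m f x.2)).
Proof.
apply/flatten_mapP/idP => [[j _ /mapP[u ug ->]] //|xg].
by exists x.2; rewrite ?mem_enum //; apply/mapP; exists x.1; last exact: surjective_pairing.
Qed.

Lemma antichain_concat : antichain_seq t.
Proof.
apply/antichainP; split=> [|x y].
  have -> : t = [seq (u, j) | j : 'I_n <- enum 'I_n,
      u : 'X_{1..m} <- greedy m (block_fun m f j)] by [].
  apply: allpairs_uniq_dep => [|j _|].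
  - exact: enum_uniq.
  - exact: greedy_uniq.
  by move=> [j u] [k w] _ _ /= [-> ->].
rewrite !mem_concat => xg + /andP[/eqP xy le]; rewrite -xy => yg.
case: x y xy xg yg le => [u j] [w k] /= -> ug wg le.
by rewrite (greedy_antichain (@block_fun_incr k) ug wg le).
Qed.

(** The shift in [block_fun] makes the degrees continue from one block to the
    next. *)
Lemma degs_concat : [seq pt_deg x | x <- t] = [seq f i.+1 | i <- iota 0 (start n)].
Proof.
have degs_block (j : 'I_n) : [seq pt_deg x | x <- greedy_block m f j] =
    [seq f i.+1 | i <- iota (start j) (block_length m f j)].
  rewrite -map_comp -[start j]addn0 iotaDl -map_comp.
  apply: (@eq_from_nth _ 0); rewrite ?size_map ?size_iota // => i ig.
  rewrite (nth_map 0%MM) // (nth_map 0) ?size_iota // nth_iota //=.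
  by rewrite /pt_deg mdeg_greedy // /block_fun addSn addnC.
rewrite map_flatten -map_comp (eq_map degs_block).
rewrite (map_comp (map (fun i => f i.+1)) (fun j : 'I_n => iota (start j) (block_length m f j))).
rewrite -map_flatten; congr map.
rewrite (map_comp (fun j => iota (start j) (block_length m f j)) val) val_enum_ord.
elim: n => // k IH; rewrite -addn1 iotaD map_cat flatten_cat IH add0n /= cats0.
by rewrite addn1 -[X in _ ++ iota X _]add0n -iotaD.
Qed.

Lemma size_concat : size t = start n.
Proof. by have := congr1 size degs_concat; rewrite !size_map size_iota. Qed.

Lemma start_mono : {homo start : i j / i <= j}.
Proof. by apply: (homo_leq leqnn leq_trans) => j /=; apply: leq_addr. Qed.

Lemma divided_full y : f (start y.2.+1).+1 <= pt_deg y -> divided t y.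
Proof.
move=> dy; have [|z zg zy] := @greedy_full m (block_fun m f y.2) y.1.
  by rewrite /block_fun addSn addnC.
by apply/hasP; exists (z, y.2); rewrite ?mem_concat // /pt_le eqxx.
Qed.

(** In an earlier copy the greedy sequence had stopped before [x] was chosen, in a
    degree not exceeding that of [x], so that [y] is above one of its points; in
    the same copy this is [greedy_above]. *)
Lemma divided_before x y : x \in t -> pt_deg y = pt_deg x -> before y x -> divided t y.
Proof.
rewrite mem_concat => xg dy; case/orP=> [lt|/andP[/eqP e le]].
  apply: divided_full; rewrite dy; move: xg => /(nthP 0%MM)[i ig /esym xE].
  rewrite /pt_deg xE mdeg_greedy // /block_fun f_incr //.
  by rewrite addSn ltnS (leq_trans (start_mono lt)) // leq_addl.
have [z zg zy] := greedy_above xg dy le.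
by apply/hasP; exists (z, y.2); rewrite ?mem_concat /= ?e // /pt_le /= e eqxx.
Qed.

End Concat.

(** * Maximality *)

Lemma leq_count_pointwise d (u w : seq nat) : size u <= size w ->
  (forall i, i < size u -> nth 0 w i <= nth 0 u i) ->
  count (leq^~ d) u <= count (leq^~ d) w.
Proof.
elim: u w => [|a u IH] [|b w] //= sz le; apply: leq_add.
  by have := le 0 isT => /= ba; case: (leqP a d) => // ad; rewrite (leq_trans ba ad).
by apply: IH => // i; apply: (le i.+1).
Qed.

Theorem proposition3p13 (m n : nat) (f : nat -> nat)
    (m_gt0 : 0 < m) (n_gt0 : 0 < n) (f_incr : {homo f : i j / i <= j}) :
  [/\ antichain_seq (greedy_concat m n f),
      degree_growth_le f (greedy_concat m n f),
      (forall s : seq ('X_{1..m} * 'I_n),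
         antichain_seq s -> degree_growth_le f s ->
         size s <= size (greedy_concat m n f))
    & is_max_antichain_length m n f (\sum_(j < n) block_length m f j)].
Proof.
set t := greedy_concat m n f.
have st : size t = block_start m f n := size_concat m n f.
have anti_t : antichain_seq t by apply: antichain_concat.
have growth_t : degree_growth_le f t.
  move=> i; have x0 := tnth (in_tuple t) i; rewrite (tnth_nth x0) /=.
  rewrite -(nth_map x0 0) // degs_concat (nth_map 0) ?size_iota -?st //.
  by rewrite nth_iota -?st.
suff max (s : seq ('X_{1..m} * 'I_n)) : antichain_seq s -> degree_growth_le f s -> size s <= size t.
  rewrite -(block_startE m f n) -st; split=> //.
  by split=> //; exists t.
move=> anti_s growth_s; rewrite leqNgt; apply/negP => lt.
have le_s k : k <= size s -> forall d,
    count (leq^~ d) [seq f i.+1 | i <- iota 0 k] <= low_count d s.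
  move=> ks d; rewrite /low_count -(count_map (@pt_deg m n) (leq^~ d)).
  apply: leq_count_pointwise.
    by rewrite !size_map size_iota.
  move=> i; rewrite size_map size_iota => ik; have si := leq_trans ik ks.
  rewrite [leqRHS](nth_map 0) ?size_iota // nth_iota //.
  have x0 := tnth (in_tuple s) (Ordinal si).
  by have := growth_s (Ordinal si); rewrite (tnth_nth x0) (nth_map x0).
have ts d : low_count d t <= low_count d s.
  by rewrite /low_count -(count_map (@pt_deg m n) (leq^~ d)) degs_concat -st le_s // ltnW.
have it := initial_ideal (@divided_before m n f f_incr).
set d := f (size t).+1.
(* All blocks have stopped by the degree which would be required of one more
   element. *)
have full : ideal t d = layer m n m d.
  apply/fsetP => x; rewrite idealP layerP; case: eqP => //= dx.
  apply: divided_full; rewrite dx f_incr // ltnS st.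
  exact: start_mono.
have := ideal_excess m_gt0 anti_s it ts d.
have sub : ideal s d `<=` layer m n m d.
  by apply/fsubsetP => x; rewrite idealP layerP => /andP[].
rewrite full -/t; move/leq_trans => /(_ _ (fsubset_leq_card sub)).
have := le_s _ lt d; rewrite (_ : count _ _ = (size t).+1); last first.
  rewrite -[RHS](size_iota 0) -(size_map (fun i => f i.+1)).
  apply/eqP; rewrite -all_count; apply/allP => _ /mapP[i + ->]; rewrite mem_iota => /andP[_ ik].
  by rewrite f_incr.
have : low_count d t <= size t by apply: count_size.
lia.
Qed.
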